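(* Let $\widehat Y\in\mathcal S(E)$ with $\widehat Y\ge0$ entrywise. The problem $$\min_{C\in\mathcal S}\bigl\{C\bullet\widehat Y:\ C\in\mathcal D^*,\ C_{ij}=0\ \forall(i,j)\notin E,\ \|\mathrm{diag}(C)\|_1\le1\bigr\}$$ is equivalent to the problem $$\min_{C\in\mathcal S}\bigl\{C\bullet\widehat Y:\ C\succeq0,\ C_{ij}\le0\ \forall(i,j)\notin E,\ \|\mathrm{diag}(C)\|_1\le1\bigr\}.$$
   Context: All matrices are real of size $(n+1)\times(n+1)$ with rows and columns indexed by $0,1,\dots,n$. $\mathcal S$ is the space of symmetric such matrices, $\mathcal S^+\subset\mathcal S$ is the cone of positive semidefinite ones ($C\succeq0$ means $C\in\mathcal S^+$), and $A\bullet B=\operatorname{tr}(B^\top A)$ is the trace inner product. $\mathrm{diag}(C)$ is the vector of diagonal entries of $C$. $\mathcal D=\mathcal S^+\cap\mathbb R_{\ge0}^{(n+1)\times(n+1)}$ is the doubly nonnegative cone, and $\mathcal D^*=\mathcal S^++\mathbb R_{\ge0}^{(n+1)\times(n+1)}$ (Minkowski sum) is its dual cone. Given symmetric matrices $Q^0,\dots,Q^m\in\mathcal S$ (the data matrices of the objective and constraints of a quadratically constrained quadratic program in nonnegative variables $x\in\mathbb R^n$, after lifting), the sparsity pattern is $$E=\{(i,j)\in\{0,\dots,n\}^2: i=0\text{ or }j=0\text{ or }i=j\text{ or }Q^k_{ij}\ne0\text{ for some }k\in\{0,\dots,m\}\},$$ and $\mathcal S(E)=\{Y\in\mathcal S: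 Y_{ij}=0\ \forall (i,j)\notin E\}$. The matrix $\widehat Y$ plays the role of the current solution of a linear programming relaxation. The first problem seeks a maximally violated (normalized) inequality $C\bullet Y\ge0$ with $C\in\mathcal D^*\cap\mathcal S(E)$. *)

(* Defs.v *)
(* MathComp / MathComp-Analysis *)
From mathcomp Require Export all_boot all_order all_algebra.
From mathcomp Require Export boolp classical_sets reals.
Export Order.TTheory GRing.Theory Num.Theory.

Set Implicit Arguments.
Unset Strict Implicit.
Unset Printing Implicit Defensive.

Local Open Scope classical_set_scope.
Local Open Scope ring_scope.

Definition mxinner (R : realType) (n : nat) (A B : 'M[R]_n) : R :=
  \tr (B^T *m A).

Definition symmx (R : realType) (n : nat) : set 'M[R]_n :=
  [set C | C \is symmetricmx].

Definition psd (R : realType) (n : nat) : set 'M[R]_n :=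
  symmx (n := n) `&` [set C | forall x : 'cV[R]_n, 0 <= (x^T *m C *m x) 0 0].

Definition nonneg (R : realType) (n : nat) : set 'M[R]_n :=
  [set C | C \is a mxOver Num.nneg].

(* The dual of the doubly nonnegative cone, in its Minkowski sum form; the
   nonnegative summand is not required to be symmetric. *)
Definition dnn_dual (R : realType) (n : nat) : set 'M[R]_n :=
  [set S + N | S in psd (n := n) & N in nonneg (n := n)].

Definition diag_norm1 (R : realType) (n : nat) (C : 'M[R]_n) : R :=
  \sum_(i < n) `|C i i|.

Definition sparsity (R : realType) (n m : nat)
    (Q : 'I_m.+1 -> 'M[R]_n.+1) : rel 'I_n.+1 :=
  fun i j => [|| i == ord0, j == ord0, i == j | [exists k, Q k i j != 0]].

Definition symmx_on (R : realType) (n : nat) (E : rel 'I_n) : set 'M[R]_n :=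
  symmx (n := n) `&` [set C | forall i j, ~~ E i j -> C i j = 0].

Definition dnn_feasible (R : realType) (n : nat) (E : rel 'I_n) :
    set 'M[R]_n :=
  [set C | [/\ C \is symmetricmx, dnn_dual C,
               (forall i j, ~~ E i j -> C i j = 0) & diag_norm1 C <= 1]].

Definition psd_feasible (R : realType) (n : nat) (E : rel 'I_n) :
    set 'M[R]_n :=
  [set C | [/\ C \is symmetricmx, psd C,
               (forall i j, ~~ E i j -> C i j <= 0) & diag_norm1 C <= 1]].

(* An optimal value is an attained minimum, not merely an infimum. *)
Definition optimal_value (R : realType) (T : Type) (F : set T) (f : T -> R)
    (v : R) : Prop :=
  (f @` F) v /\ lbound (f @` F) v.

Definition optimal_solution (R : realType) (T : Type) (F : set T) (f : T -> R)
    (x : T) : Prop :=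
  F x /\ lbound (f @` F) (f x).

Definition restrict_mx (R : realType) (n : nat) (E : rel 'I_n) (S : 'M[R]_n) :
    'M[R]_n :=
  \matrix_(i, j) (if E i j then S i j else 0).

(* Equivalence of the two problems of minimizing mxinner C Y over C: both attain
   their minimum, with the same value, and optimal solutions of either yield
   optimal solutions of the other, by zeroing the entries outside E in one
   direction and by keeping the semidefinite summand of any decomposition in
   the other. *)
Definition equivalent_problems (R : realType) (n : nat) (E : rel 'I_n)
    (Y : 'M[R]_n) : Prop :=
  let obj := fun C : 'M[R]_n => mxinner C Y in
  [/\ exists v : R, optimal_value (dnn_feasible E) obj v /\
                    optimal_value (psd_feasible E) obj v,
      forall S : 'M[R]_n, optimal_solution (psd_feasible E) obj S ->
        optimal_solution (dnn_feasible E) obj (restrict_mx E S)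
    & forall S N : 'M[R]_n, psd S -> nonneg N ->
        optimal_solution (dnn_feasible E) obj (S + N) ->
        optimal_solution (psd_feasible E) obj S].

(* Main.v *)
Require Import Defs.
From mathcomp Require Import topology normedtype derive.
From mathcomp Require Import lra.
Import numFieldNormedType.Exports.

Set Implicit Arguments.
Unset Strict Implicit.
Unset Printing Implicit Defensive.

Local Open Scope classical_set_scope.
Local Open Scope ring_scope.

(** Let C = S + N be feasible for the first problem, with S positive
    semidefinite and N entrywise nonnegative.  Off E the entries of C vanish, so
    those of S are the opposites of those of N, hence nonpositive; and the
    diagonal of S is nonnegative and bounded by that of C.  So S is feasible for
    the second problem ([psd_summand_feasible]), at no greater cost because
    Y >= 0 ([mxinner_le_addr]).  Conversely, if S is feasible for the second
    problem, zeroing its entries outside E amounts to adding the nonnegative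
    matrix of their opposites, so the result is feasible for the first problem
    ([restrict_feasible]), at equal cost because Y lives on E
    ([mxinner_restrict]).  These two cost-nonincreasing maps carry optimal
    solutions to optimal solutions and identify the optimal values.

    That a minimum is attained at all is a compactness argument, which needs
    only be made for the second problem ([psd_feasible_min]): its feasible set
    is closed, and it is bounded because the entries of a positive semidefinite
    matrix are dominated by its diagonal ([psd_entry_le]). *)

Lemma symmxP (R : realType) n (C : 'M[R]_n) :
  C \is symmetricmx <-> forall i j, C i j = C j i.
Proof.
split=> [/is_hermitianmxP h i j|h].
  by rewrite {1}h expr0 scale1r !mxE.
apply/is_hermitianmxP/matrixP => i j.
by rewrite expr0 scale1r !mxE /= h.
Qed.

Lemma mxinnerE (R : realType) n (A B : 'M[R]_n) :
  mxinner A B = \sum_i \sum_j A i j * B i j.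
Proof.
rewrite /mxinner /mxtrace exchange_big; apply: eq_bigr => j _ /=.
by rewrite mxE; apply: eq_bigr => i _; rewrite mxE mulrC.
Qed.

(** At a fixed x the quadratic form is linear in C, so each inequality defining
    positive semidefiniteness cuts out a closed half-space. *)
Lemma quad_form_mxinner (R : realType) n (C : 'M[R]_n) (x : 'cV[R]_n) :
  (x^T *m C *m x) 0 0 = mxinner C (x *m x^T).
Proof.
rewrite /mxinner trmx_mul trmxK -[_ *m x^T *m C]mulmxA mxtrace_mulC.
by rewrite /mxtrace big_ord1.
Qed.

Lemma mxinner_le_addr (R : realType) n (S N Y : 'M[R]_n) :
  nonneg N -> nonneg Y -> mxinner S Y <= mxinner (S + N) Y.
Proof.
move=> /mxOverP N0 /mxOverP Y0; rewrite !mxinnerE.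
apply: ler_sum => i _; apply: ler_sum => j _.
by rewrite mxE mulrDl lerDl mulr_ge0// -nnegrE.
Qed.

Lemma mxinner_restrict (R : realType) n (E : rel 'I_n) (S Y : 'M[R]_n) :
  (forall i j, ~~ E i j -> Y i j = 0) ->
  mxinner (restrict_mx E S) Y = mxinner S Y.
Proof.
move=> YE; rewrite !mxinnerE.
apply: eq_bigr => i _; apply: eq_bigr => j _; rewrite mxE.
by case: (boolP (E i j)) => // /YE ->; rewrite !mulr0.
Qed.

Lemma psd_diag_ge0 (R : realType) n (C : 'M[R]_n) i : psd C -> 0 <= C i i.
Proof.
move=> [_ /(_ (delta_mx i 0))].
by rewrite trmx_delta -rowE -colE !mxE.
Qed.

Lemma psd_summand_feasible (R : realType) n (E : rel 'I_n) (S N : 'M[R]_n) :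
  psd S -> nonneg N -> dnn_feasible E (S + N) -> psd_feasible E S.
Proof.
move=> Spsd /mxOverP N0 [_ _ SNE SN1]; split=> //; first by case: Spsd.
  by move=> i j /SNE; rewrite mxE; have := N0 i j; rewrite nnegrE; lra.
apply: le_trans SN1; apply: ler_sum => i _.
have Sii := psd_diag_ge0 i Spsd; have := N0 i i; rewrite nnegrE => Nii.
by rewrite mxE !ger0_norm ?addr_ge0// lerDl.
Qed.

(** Symmetry of E keeps the restricted matrix symmetric, and reflexivity keeps
    its diagonal, hence the norm constraint, unchanged. *)
Lemma restrict_feasible (R : realType) n (E : rel 'I_n) (S : 'M[R]_n) :
  reflexive E -> symmetric E ->
  psd_feasible E S -> dnn_feasible E (restrict_mx E S).
Proof.
move=> Erefl Esym [/symmxP Ssym Spsd SE S1]; split.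
- by apply/symmxP => i j; rewrite !mxE Esym Ssym.
- exists S => //; exists (restrict_mx E S - S); last by rewrite addrC subrK.
  apply/mxOverP => i j; rewrite !mxE nnegrE.
  by case: (boolP (E i j)) => [_|/SE]; rewrite ?subrr// sub0r oppr_ge0.
- by move=> i j /negbTE nE; rewrite mxE nE.
- by rewrite /diag_norm1; under eq_bigr do rewrite mxE Erefl.
Qed.

(** Testing C on e_i + e_j and e_i - e_j gives 2 |C i j| <= C i i + C j j, and
    every diagonal entry is at most the sum of all their absolute values. *)
Lemma psd_entry_le (R : realType) n (C : 'M[R]_n) i j :
  psd C -> `|C i j| <= diag_norm1 C.
Proof.
move=> Cpsd; have [/symmxP Csym Cge0] := Cpsd.
have diagle k : C k k <= diag_norm1 C.
  rewrite /diag_norm1 (bigD1 k)//= (le_trans (ler_norm _))// lerDl.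
  exact: sumr_ge0.
have pm (s : R) : 0 <= C i i + s * C i j + (s * C j i + s * s * C j j).
  have := Cge0 (delta_mx i 0 + s *: delta_mx j 0).
  have -> : (delta_mx i 0 + s *: delta_mx j 0)^T =
      delta_mx 0 i + s *: delta_mx 0 j :> 'rV[R]_n.
    by apply/matrixP => a b; rewrite !mxE !(andbC (a == _)).
  rewrite !(mulmxDl, mulmxDr) -!(scalemxAl, scalemxAr) -!rowE -!colE !mxE.
  lra.
have := pm 1; have := pm (-1); have := diagle i; have := diagle j.
rewrite (Csym j i) ler_norml => *; apply/andP; split; lra.
Qed.

(** Boxes of row vectors are compact by Tychonoff; reshaping a row vector
    into a matrix is continuous and transports this to matrices. *)
Lemma mx_coord_compact (R : realType) m n (r : R) :
  compact [set C : 'M[R]_(m, n) | forall i j, `|C i j| <= r].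
Proof.
have -> : [set C : 'M[R]_(m, n) | forall i j, `|C i j| <= r] =
    vec_mx @` [set v : 'rV[R]_(m * n) | forall k, `[- r, r]%classic (v ord0 k)].
  apply/seteqP; split => [C Cr|_ [v vr <-]] /=.
    exists (mxvec C); last exact: mxvecK.
    move=> k; case/mxvec_indexP: k => i j.
    by rewrite /= mxvecE in_itv/= -ler_norml.
  move=> i j; rewrite mxE ler_norml.
  by have := vr (mxvec_index i j); rewrite /= in_itv.
apply: continuous_compact.
  apply: continuous_subspaceT => v B /nbhs_ballP[e e0 ev].
  apply/nbhs_ballP; exists e => // w [_ vw]; apply: ev.
  by split=> // i j; rewrite !mxE; exact: vw.
apply: (@rV_compact _ _ (fun=> `[- r, r]%classic)) => _.
exact: segment_compact.
Qed.

Lemma mxinner_continuous (R : realType) n (B : 'M[R]_n) :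
  continuous ((@mxinner R n)^~ B).
Proof.
have -> : (@mxinner R n)^~ B = fun C => \sum_i \sum_j C i j * B i j.
  by apply/funext => C; exact: mxinnerE.
apply: continuous_big => [|i _]; first exact: add_continuous.
apply: continuous_big => [|j _]; first exact: add_continuous.
move=> C; apply: continuousM; first exact: coord_continuous.
exact: cst_continuous.
Qed.

Lemma diag_norm1_continuous (R : realType) n :
  continuous (@diag_norm1 R n : 'M[R]_n -> R).
Proof.
apply: continuous_big => [|i _]; first exact: add_continuous.
move=> C; apply: continuous_comp; first exact: coord_continuous.
exact: norm_continuous.
Qed.

Lemma closed_sublevels (R : realType) (T : topologicalType) I (P : set I)
    (f : I -> T -> R) (b : R) :
  (forall i, P i -> continuous (f i)) ->
  closed [set x | forall i, P i -> f i x <= b].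
Proof.
move=> fcont; have -> : [set x | forall i, P i -> f i x <= b] =
    \bigcap_(i in P) (f i @^-1` [set y | y <= b]) by apply/seteqP; split.
apply: closed_bigI => i Pi; apply: preimage_closed; last exact: closed_le.
by move=> x _; exact: fcont.
Qed.

(** Each constraint bounds a continuous function of C from above: an equality
    C i j = C j i is two such inequalities, and the quadratic form at a fixed x
    is linear in C. *)
Lemma psd_feasible_closed (R : realType) n (E : rel 'I_n) :
  closed (psd_feasible E : set 'M[R]_n).
Proof.
pose sym := [set C : 'M[R]_n | forall p : 'I_n * 'I_n, True ->
  C p.1 p.2 - C p.2 p.1 <= 0].
pose quad := [set C : 'M[R]_n | forall x : 'cV[R]_n, True ->
  - mxinner C (x *m x^T) <= 0].
pose off := [set C : 'M[R]_n | forall p : 'I_n * 'I_n, ~~ E p.1 p.2 ->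
  C p.1 p.2 <= 0].
pose norm := @diag_norm1 R n @^-1` [set r | r <= 1].
have -> : psd_feasible E = sym `&` quad `&` off `&` norm.
  apply/seteqP; split => C.
    move=> [/symmxP Csym [_ Cpsd] CE C1].
    split=> //; split; last by case=> i j /CE.
    split; first by case=> i j _; rewrite /= Csym subrr.
    by move=> x _; rewrite oppr_le0 -quad_form_mxinner.
  move=> [[[Csym Cquad] Coff] C1].
  have {}Csym : C \is symmetricmx.
    apply/symmxP => i j; apply/eqP; rewrite eq_le -subr_le0 (Csym (i, j))//=.
    by rewrite -subr_le0 (Csym (j, i)).
  split=> //; last by move=> i j; exact: (Coff (i, j)).
  by split=> // x; rewrite quad_form_mxinner -oppr_le0 Cquad.
apply: closedI; first apply: closedI; first apply: closedI.
- apply: closed_sublevels => p _ C.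
  by apply: continuousB; exact: coord_continuous.
- by apply: closed_sublevels => x _ C;
    apply: (continuous_comp (@mxinner_continuous _ _ _ C));
    exact: opp_continuous.
- by apply: closed_sublevels => p _; exact: coord_continuous.
- apply: preimage_closed; last exact: closed_le.
  by move=> C _; exact: diag_norm1_continuous.
Qed.

Lemma psd_feasible_min (R : realType) n (E : rel 'I_n) (Y : 'M[R]_n) :
  exists S, optimal_solution (psd_feasible E) ((@mxinner R n)^~ Y) S.
Proof.
have F0 : (psd_feasible E : set 'M[R]_n) !=set0.
  have sym0 : (0 : 'M[R]_n) \is symmetricmx.
    by apply/symmxP => i j; rewrite !mxE.
  exists 0; split=> //; [split=> // x|move=> i j _|].
  - by rewrite mulmx0 mul0mx mxE.
  - by rewrite mxE.
  - by rewrite /diag_norm1 big1// => i _; rewrite mxE normr0.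
have Fcompact : compact (psd_feasible E : set 'M[R]_n).
  have boxcompact := @mx_coord_compact R n n 1.
  apply: (subclosed_compact (@psd_feasible_closed R n E) boxcompact).
  by move=> C [_ Cpsd _ C1] i j; exact: le_trans (psd_entry_le _ _ Cpsd) C1.
have [S SF Smin] := compact_EVT_min F0 Fcompact
  (continuous_subspaceT (@mxinner_continuous R n Y)).
exists S; split; first exact: set_mem.
by move=> _ [C CF <-]; apply: Smin; exact: mem_set.
Qed.

Theorem lemma5 (R : realType) (n m : nat) (Q : 'I_m.+1 -> 'M[R]_n.+1)
    (hQ : forall k, symmx (Q k)) (Y : 'M[R]_n.+1)
    (hY : symmx_on (sparsity Q) Y) (hY0 : nonneg Y) :
  equivalent_problems (sparsity Q) Y.
Proof.
set E := sparsity Q; have YE := hY.2.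
have Erefl : reflexive E by move=> i; rewrite /E /sparsity eqxx !orbT.
have Esym : symmetric E.
  move=> i j; rewrite /E /sparsity orbCA (eq_sym i j).
  congr [|| _, _, _ | _]; apply: eq_existsb => k.
  by have /symmxP -> := hQ k.
pose obj := (@mxinner R n.+1)^~ Y.
have restrict_opt S : optimal_solution (psd_feasible E) obj S ->
    optimal_solution (dnn_feasible E) obj (restrict_mx E S).
  move=> [SF Smin]; split; first exact: restrict_feasible.
  move=> _ [C CF <-]; rewrite /obj mxinner_restrict//.
  have [_ [S' S'psd [N N0 CE]] _ _] := CF; rewrite -CE.
  apply: le_trans (mxinner_le_addr _ N0 hY0); apply: Smin; exists S' => //.
  by apply: psd_summand_feasible S'psd N0 _; rewrite CE.
split=> // [|S N Spsd N0 [SNF SNmin]].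
  have [S Sopt] := psd_feasible_min E Y; exists (mxinner S Y).
  have [rSF rSmin] := restrict_opt S Sopt; have [SF Smin] := Sopt.
  rewrite /obj mxinner_restrict// in rSmin.
  split; split=> //; last by exists S.
  by exists (restrict_mx E S) => //; exact: mxinner_restrict.
split; first exact: psd_summand_feasible Spsd N0 SNF.
move=> _ [S' S'F <-]; apply: le_trans (mxinner_le_addr S N0 hY0) _.
rewrite -(mxinner_restrict S' YE); apply: SNmin.
by exists (restrict_mx E S') => //; exact: restrict_feasible.
Qed.
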